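(* Let $1\le c\le n-3$ and $\gamma<0$. For every connected graph $G$ of order $n$ having exactly $c$ cut edges, \[{}^0R_{\gamma}(G)\le c+(n-c-1)2^{\gamma}+(c+2)^{\gamma},\] with equality if and only if $G=C_{n-c}^c$.
   Context: ${}^0R_{\gamma}(G)=\sum_{u\in V(G)} d(u)^{\gamma}$. A cut edge is an edge whose removal disconnects the graph. $C_{n-c}^c$ is the graph obtained from the cycle $C_{n-c}$ by attaching $c$ pendant vertices to one vertex of the cycle. Graphs are finite and simple. *)

(* Defs.v *)
From mathcomp Require Import all_boot all_order all_algebra.
From mathcomp Require Import reals exp.

Set Implicit Arguments.
Unset Strict Implicit.
Unset Printing Implicit Defensive.

Import GRing.Theory.

Record sgraph := SGraph {
  vertex :> finType;
  adj : rel vertex;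
  adj_sym : symmetric adj;
  adj_irrefl : irreflexive adj
}.

Definition graph_order (G : sgraph) : nat := #|vertex G|.

Definition deg (G : sgraph) (u : G) : nat := #|[set v : G | adj u v]|.

Definition connected_graph (G : sgraph) : bool :=
  (0 < graph_order G)%N && [forall x : G, forall y : G, connect (@adj G) x y].

(* An edge is the unordered pair of its endpoints. *)
Definition edges (G : sgraph) : {set {set G}} :=
  [set [set p.1; p.2] | p : G * G & adj p.1 p.2].

Section DeleteEdge.
Variables (G : sgraph) (A : {set G}).

Definition del_edge_adj : rel G :=
  fun x y => adj x y && ([set x; y] != A).

Lemma del_edge_adj_sym : symmetric del_edge_adj.
Proof. by move=> x y; rewrite /del_edge_adj adj_sym setUC. Qed.

Lemma del_edge_adj_irrefl : irreflexive del_edge_adj.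
Proof. by move=> x; rewrite /del_edge_adj adj_irrefl. Qed.

Definition del_edge : sgraph := SGraph del_edge_adj_sym del_edge_adj_irrefl.
End DeleteEdge.

(* Meant for connected G, where removing A disconnects G exactly when the
   result is not connected. *)
Definition cut_edges (G : sgraph) : {set {set G}} :=
  [set A in edges G | ~~ connected_graph (del_edge A)].

Definition isomorphic (G H : sgraph) : Prop :=
  exists f : G -> H, bijective f /\ forall x y, adj (f x) (f y) = adj x y.

(* The cycle on 'I_k (for k >= 3): consecutive residues modulo k. *)
Definition cycle_adj (k : nat) : rel 'I_k :=
  fun i j => (i != j) &&
    ((j == i.+1 %% k :> nat) || (i == j.+1 %% k :> nat)).

Section CyclePendant.
Variables k c : nat.

(* Left summand: the cycle; right summand: c pendant vertices, all attached
   to the cycle vertex 0. *)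
Definition cycle_pendant_adj : rel ('I_k + 'I_c) := fun x y =>
  match x, y with
  | inl i, inl j => cycle_adj i j
  | inl i, inr _ => i == 0%N :> nat
  | inr _, inl j => j == 0%N :> nat
  | inr _, inr _ => false
  end.

Lemma cycle_pendant_adj_sym : symmetric cycle_pendant_adj.
Proof.
by case=> i [] j //=; rewrite /cycle_adj eq_sym orbC.
Qed.

Lemma cycle_pendant_adj_irrefl : irreflexive cycle_pendant_adj.
Proof. by case=> i //=; rewrite /cycle_adj eqxx. Qed.

Definition cycle_pendant : sgraph :=
  SGraph cycle_pendant_adj_sym cycle_pendant_adj_irrefl.
End CyclePendant.

(* powR sets 0 `^ gamma to 0 for gamma != 0; this never arises in a connected
   graph with at least two vertices. *)
Definition zeroth_randic (R : realType) (gamma : R) (G : sgraph) : R :=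
  (\sum_(u : G) ((deg u)%:R `^ gamma))%R.

(* Main.v *)
(** Write f d = d ^ gamma, a strictly decreasing, strictly convex function, and
    let p be the number of leaves.  Pendant edges are cut edges, so p <= c.
    Since a connected graph has at least n - 1 > c edges, some edge is not a
    cut edge; deleting it leaves a connected graph, so G has at least n edges.
    Hence the excesses d(u) - 2 of the non-leaves sum to at least p.  The drop
    f 2 - f (2 + a) is strictly subadditive in the excess a, so the sum is
    largest when one vertex w carries an excess of exactly p; the resulting
    bound p + (n - p - 1) f 2 + f (p + 2) strictly increases with p.

    In the case of equality p = c, so all cut edges are pendant.  A leaf
    hanging off a vertex of degree 2 would produce a non-pendant cut edge, so
    all leaves hang off w; the remaining vertices induce a connected 2-regular
    graph, that is, a cycle. *)
Require Import Defs.
From mathcomp Require Import all_boot all_order all_algebra.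
From mathcomp Require Import reals exp.
From mathcomp Require Import zify ring lra.

Import Order.TTheory GRing.Theory Num.Theory.

(** * Edges, leaves and cut edges *)

(** Connectedness enters most later arguments in this form: a set closed under adjacency that
    contains one vertex contains all of them. *)
Lemma connected_closed (G : sgraph) (S : {pred G}) (x y : G) :
  connected_graph G -> (forall u v, u \in S -> adj u v -> v \in S) ->
  x \in S -> y \in S.
Proof.
move=> /andP[_ /forallP/(_ x)/forallP/(_ y) cxy] clS xS.
have symG : connect_sym (@adj G) by apply/sym_connect_sym/adj_sym.
have clo : closed (@adj G) S by apply: intro_closed => // u v uv uS; apply: clS uv.
by rewrite -(closed_connect clo cxy).
Qed.

Lemma edge_in (G : sgraph) (x y : G) : adj x y -> [set x; y] \in edges G.
Proof. by move=> xy; apply/imsetP; exists (x, y); rewrite ?inE. Qed.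

Lemma edgeP (G : sgraph) (A : {set G}) :
  reflect (exists x y, adj x y /\ A = [set x; y]) (A \in edges G).
Proof.
apply: (iffP imsetP) => [[[x y]]|[x [y [xy ->]]]]; last by exists (x, y); rewrite ?inE.
by rewrite inE /= => xy ->; exists x, y.
Qed.

(** Grow [S] one vertex at a time: connectedness provides an edge leaving [S], and adding its outer
    end gains at least that edge. *)
Lemma connected_edges_within (G : sgraph) (k : nat) : connected_graph G ->
  (k < #|G|)%N -> exists S : {set G}, #|S| = k.+1 /\
    (k <= #|[set A in edges G | A \subset S]|)%N.
Proof.
move=> conG; elim: k => [|k IHk] ltk.
  by have /card_gt0P[x _] := ltk; exists [set x]; rewrite cards1.
have [S [cS leS]] := IHk (ltnW ltk).
have [x xS] : exists x, x \in S by apply/card_gt0P; rewrite cS.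
have [y yS] : exists y, y \notin S.
  apply/existsP; apply: contraTT ltk => /existsPn H; rewrite -leqNgt -cS.
  by apply/subset_leq_card/subsetP => u _; have := H u; rewrite negbK.
have [u [v [uS vS uv]]] : exists u v, [/\ u \in S, v \notin S & adj u v].
  have [/existsP[u /existsP[v /and3P[uS vS uv]]]|H] :=
    boolP [exists u, exists v, [&& u \in S, v \notin S & adj u v]].
    by exists u, v.
  case/negP: yS; apply: (@connected_closed G (mem S) x y) => // u v uS uv.
  apply: contraNT H => vS; apply/existsP; exists u; apply/existsP; exists v.
  by apply/and3P.
exists (v |: S); split; first by rewrite cardsU1 vS cS.
apply: leq_trans (_ : #|[set u; v] |: [set A in edges G | A \subset S]| <= _)%N.
  rewrite cardsU1 inE edge_in //= subUset !sub1set uS (negPf vS) /=.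
  by rewrite add1n ltnS.
apply: subset_leq_card; apply/subsetP => A; rewrite !inE => /orP[/eqP->|/andP[-> sA]].
  by rewrite edge_in //= subUset !sub1set !inE uS eqxx orbT.
by rewrite (subset_trans sA) ?subsetUr.
Qed.

Lemma connected_edges_ge (G : sgraph) : connected_graph G -> (#|G|.-1 <= #|edges G|)%N.
Proof.
move=> conG; have /andP[G0 _] := conG.
have [|S [_ leS]] := @connected_edges_within G #|G|.-1 conG.
  by rewrite prednK.
apply: leq_trans leS _; apply/subset_leq_card/subsetP => A.
by rewrite inE => /andP[].
Qed.

Lemma set2_eqP (T : finType) (a b x y : T) : [set x; y] = [set a; b] ->
  (x = a /\ y = b) \/ (x = b /\ y = a).
Proof.
move/setP=> H; have := H x; have := H y; have := H a; have := H b.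
rewrite !inE !eqxx ?orbT /= => /orP[]/eqP eb /orP[]/eqP ea /esym/orP[]/eqP ey /esym/orP[]/eqP ex;
  by [left; split; congruence | right; split; congruence].
Qed.

Lemma del_edge_edges (G : sgraph) (A : {set G}) : edges (del_edge A) = edges G :\ A.
Proof.
apply/setP => B; rewrite !inE; apply/edgeP/andP.
  by case=> x [y [/andP[xy nA] ->]]; split => //; apply: edge_in.
by case=> BA /edgeP[x [y [xy BE]]]; exists x, y; rewrite /adj /= /del_edge_adj xy -BE.
Qed.

(** Double counting of ordered adjacent pairs: grouped by first vertex they give the degrees,
    grouped by underlying edge they come in twos. *)
Lemma handshake (G : sgraph) : (\sum_(u : G) deg u = 2 * #|edges G|)%N.
Proof.
transitivity (\sum_(q : G * G | adj q.1 q.2) 1)%N.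
  rewrite (eq_bigr (fun u => \sum_(v | adj u v) 1)%N).
    by rewrite pair_big_dep.
  by move=> u _; rewrite /deg sum1dep_card.
rewrite (partition_big (fun q : G * G => [set q.1; q.2]) (mem (edges G))) /=; last first.
  by move=> q qa; apply: edge_in.
rewrite (eq_bigr (fun=> 2%N)); first by rewrite sum_nat_const mulnC.
move=> A /edgeP[x [y [xy ->]]].
have nxy : x != y by apply: contraTneq xy => ->; rewrite adj_irrefl.
rewrite sum1dep_card (_ : [set _ | _] = [set (x, y); (y, x)]).
  by rewrite cards2 xpair_eqE (negPf nxy).
apply/setP => -[a b]; rewrite !inE /= !xpair_eqE; apply/andP/orP.
  by case=> _ /eqP/set2_eqP[][-> ->]; rewrite !eqxx; [left|right].
by case=> /andP[/eqP-> /eqP->]; rewrite ?xy ?eqxx // adj_sym xy setUC eqxx.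
Qed.

(** Counting yields a non-cut edge [A]; the tree bound applied to the graph without [A] gains the
    one edge that raises the degree sum from 2(n - 1) to 2n. *)
Lemma few_cut_edges_deg_sum (G : sgraph) : connected_graph G ->
  (#|cut_edges G| + 1 < #|G|)%N -> (2 * #|G| <= \sum_(u : G) deg u)%N.
Proof.
move=> conG ltc; rewrite handshake leq_mul2l /=.
have [A AE nA] : exists2 A, A \in edges G & A \notin cut_edges G.
  apply/subsetPn/negP => /subset_leq_card.
  have := connected_edges_ge G conG; lia.
have conD : connected_graph (del_edge A).
  by move: nA; rewrite inE AE /= negbK.
have := connected_edges_ge _ conD; rewrite del_edge_edges (cardsD1 A (edges G)) AE /=.
by rewrite add1n -ltnS prednK //; apply: leq_trans ltc.
Qed.

Lemma connected_deg_gt0 (G : sgraph) (u : G) : connected_graph G -> (1 < #|G|)%N ->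
  (0 < deg u)%N.
Proof.
move=> conG G1; rewrite lt0n; apply/negP => /eqP/cards0_eq N0.
have [y yu] : exists y : G, y \notin [set u].
  apply/existsP; apply: contraTT G1 => /existsPn H; rewrite -leqNgt -(cards1 u).
  by apply/subset_leq_card/subsetP => v _; have := H v; rewrite negbK.
have := @connected_closed G (mem [set u]) u y conG; rewrite (negPf yu) => H.
suff: false by []; apply: H; last by rewrite inE.
by move=> a b /set1P -> ab; have := in_set0 b; rewrite -N0 inE ab.
Qed.

Definition leaves (G : sgraph) : {set G} := [set u : G | deg u == 1%N].
(** For a leaf this two-element set is its pendant edge, so it serves as the map from leaves to cut
    edges. *)
Definition closed_nbhd (G : sgraph) (u : G) : {set G} := u |: [set v | adj u v].

Lemma leaf_nbr (G : sgraph) (u : G) : u \in leaves G ->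
  exists2 v, adj u v & forall x, adj u x -> x = v.
Proof.
rewrite inE => /cards1P[v E]; exists v.
  by have := set11 v; rewrite -E inE.
by move=> x ux; apply/set1P; rewrite -E inE.
Qed.

Lemma leaf_closed_nbhd (G : sgraph) (u v : G) : u \in leaves G -> adj u v ->
  closed_nbhd G u = [set u; v].
Proof.
move=> uL uv; have [v' _ H] := leaf_nbr _ _ uL.
rewrite /closed_nbhd; congr (_ |: _); apply/setP => x; rewrite !inE.
by apply/idP/eqP => [/H ->|->//]; rewrite (H v).
Qed.

(** A certificate for cut edges: a side [S] that no edge other than xy leaves. *)
Lemma cut_edge_closed (G : sgraph) (S : {pred G}) (x y : G) : adj x y ->
  x \in S -> y \notin S ->
  (forall u v, u \in S -> adj u v -> [set u; v] != [set x; y] -> v \in S) ->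
  [set x; y] \in cut_edges G.
Proof.
move=> xy xS yS H; rewrite inE edge_in //=; apply: contra yS => conD.
apply: (@connected_closed (del_edge [set x; y]) S x) => // u v uS /andP[uv n].
exact: H uv n.
Qed.

Lemma leaf_cut_edge (G : sgraph) (u : G) : u \in leaves G -> closed_nbhd G u \in cut_edges G.
Proof.
move=> uL; have [v uv H] := leaf_nbr _ _ uL; rewrite (leaf_closed_nbhd _ _ v) //.
apply: (@cut_edge_closed G (mem [set u])) => //; first by rewrite inE.
  by rewrite inE; apply: contraTneq uv => ->; rewrite adj_irrefl.
by move=> a b /set1P -> ub; rewrite (H b) ?eqxx.
Qed.

(** Two adjacent leaves would form a whole component, hence a graph on two vertices. *)
Lemma leaf_not_adj (G : sgraph) (u v : G) : connected_graph G -> (2 < #|G|)%N ->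
  u \in leaves G -> v \in leaves G -> ~~ adj u v.
Proof.
move=> conG G2 uL vL; apply/negP => uv.
have [v' _ Hu] := leaf_nbr _ _ uL; have [u' _ Hv] := leaf_nbr _ _ vL.
have vu : adj v u by rewrite adj_sym.
suff : (#|G| <= 2)%N by rewrite leqNgt G2.
apply: leq_trans (_ : #|[set u; v]| <= 2)%N; last by rewrite cards2; case: (_ != _).
apply/subset_leq_card/subsetP => y _.
apply: (@connected_closed G (mem [set u; v]) u) => //; last by rewrite !inE eqxx.
move=> a b /set2P[]-> ab; rewrite !inE.
  by rewrite (Hu b) // -(Hu v) // eqxx orbT.
by rewrite (Hv b) // -(Hv u) // eqxx.
Qed.

Lemma leaf_closed_nbhd_inj (G : sgraph) : connected_graph G -> (2 < #|G|)%N ->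
  {in leaves G &, injective (closed_nbhd G)}.
Proof.
move=> conG G2 u v uL vL E; apply/eqP; apply: contraNT (leaf_not_adj _ u v conG G2 uL vL).
have : v \in closed_nbhd G u by rewrite E !inE eqxx.
by rewrite !inE eq_sym => /orP[->|].
Qed.

Lemma leaves_le_cut_edges (G : sgraph) : connected_graph G -> (2 < #|G|)%N ->
  (#|leaves G| <= #|cut_edges G|)%N.
Proof.
move=> conG G2; rewrite -(card_in_imset (leaf_closed_nbhd_inj _ conG G2)).
by apply/subset_leq_card/subsetP => A /imsetP[u uL ->]; apply: leaf_cut_edge.
Qed.

(** The injection sending a leaf to its pendant edge is onto when the cardinalities agree. *)
Lemma cut_edges_leaves (G : sgraph) : connected_graph G -> (2 < #|G|)%N ->
  #|leaves G| = #|cut_edges G| -> cut_edges G = closed_nbhd G @: leaves G.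
Proof.
move=> conG G2 E; apply/esym/eqP; rewrite eqEcard.
rewrite (card_in_imset (leaf_closed_nbhd_inj _ conG G2)) E leqnn andbT.
by apply/subsetP => A /imsetP[u uL ->]; apply: leaf_cut_edge.
Qed.

(* Beyond a degree-2 neighbour of a leaf lies a second cut edge, which would
   have to be pendant as well. *)
Lemma leaf_nbr_deg (G : sgraph) (v u : G) : connected_graph G -> (3 < #|G|)%N ->
  #|leaves G| = #|cut_edges G| -> v \in leaves G -> adj v u -> deg u != 2.
Proof.
move=> conG G3 E vL vu; apply/negP => du.
have G2 := ltnW G3.
have uv : adj u v by rewrite adj_sym.
have [u' _ Hv] := leaf_nbr _ _ vL.
have Hv' x : adj v x -> x = u by move=> vx; rewrite (Hv x vx) (Hv u vu).
have : #|[set x | adj u x] :\ v| = 1%N.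
  by have := du; rewrite /deg (cardsD1 v) inE uv /= => /eqP[].
case/eqP/cards1P=> z Nz.
have : z \in [set x | adj u x] :\ v by rewrite Nz set11.
rewrite !inE => /andP[zv uz].
have Hu x : adj u x -> x = v \/ x = z.
  move=> ux; case: (eqVneq x v) => [->|xv]; [by left|right].
  by apply/set1P; rewrite -Nz !inE xv.
have zu : z != u by apply: contraTneq uz => ->; rewrite adj_irrefl.
(* Only the edge uz leaves the side {u, v}. *)
have : [set u; z] \in cut_edges G.
  apply: (@cut_edge_closed G (mem [set u; v])) => //; rewrite ?inE ?eqxx //.
    by rewrite negb_or zu.
  move=> a b /set2P[]-> ab; rewrite !inE; last by rewrite (Hv' b) ?eqxx.
  by case: (Hu b ab) => ->; rewrite eqxx // orbT.
rewrite (cut_edges_leaves _ conG G2 E) => /imsetP[l lL].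
have : l \in closed_nbhd G l by rewrite !inE eqxx.
move=> + EE; rewrite -EE => /set2P[] ll.
  by move: lL; rewrite ll inE (eqP du).
have [y _ Hz] := leaf_nbr _ _ lL.
(* The leaf [l] is not [u], which has degree 2, so it is [z]; then {u, v, z} is closed under
   adjacency. *)
suff : (#|G| <= 3)%N by rewrite leqNgt G3.
apply: leq_trans (_ : #|[set u; v; z]| <= 3)%N; last first.
  by rewrite setUC cardsU1 cards2; case: (_ != _); case: (_ \notin _).
apply/subset_leq_card/subsetP => q _.
apply: (@connected_closed G (mem [set u; v; z]) u) => //; last by rewrite !inE eqxx.
move=> a b; rewrite !inE => /orP[/orP[]|]/eqP-> ab.
- by case: (Hu b ab) => ->; rewrite eqxx ?orbT.
- by rewrite (Hv' b) ?eqxx.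
- by subst l; rewrite (Hz b ab) -(Hz u) ?eqxx // adj_sym.
Qed.

(** * Cycles in 2-regular graphs and the extremal graph *)

(** Extend a simple path at its front while possible; [k] bounds the room left. At a dead end [y],
    all [P]-neighbours lie on the path, and one other than the next vertex closes a cycle. *)
Lemma min_deg2_cycle (T : finType) (e : rel T) (P : pred T) (x : T) :
  symmetric e -> irreflexive e ->
  (forall y, P y -> (1 < #|[set z | e y z && P z]|)%N) -> P x ->
  exists s, [/\ cycle e s, uniq s, (2 < size s)%N & all P s].
Proof.
move=> symE irrE deg2 Px.
suff extend k (y : T) p : path e y p -> uniq (y :: p) -> all P (y :: p) ->
    (#|T| - size p <= k)%N ->
    exists s, [/\ cycle e s, uniq s, (2 < size s)%N & all P s].
  by apply: (extend #|T| x [::]); rewrite //= ?Px ?leq_subr.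
elim: k y p => [|k IHk] y p pp up Pp lek.
  have : (size (y :: p) <= #|T|)%N by rewrite -(card_uniqP up) max_card.
  by move: lek => /=; case: #|T| => [|t]; lia.
have [/existsP[z /and3P[yz Pz zp]]|H] :=
  boolP [exists z, [&& e y z, P z & z \notin y :: p]].
  apply: (IHk z (y :: p)); rewrite /= 1?symE ?yz ?Pz //; last by move: lek; rewrite leq_subLR leq_subLR addSnnS.
  by move: up zp => /= -> ->.
have inp z : e y z -> P z -> z \in p.
  move=> yz Pz; have /existsPn/(_ z) := H; rewrite yz Pz /= negbK inE.
  by case/predU1P=> // zy; move: yz; rewrite zy irrE.
have Py : P y by move: Pp => /= /andP[].
case: p => [|z p] in pp up Pp lek H inp *.
  have /card_gt0P[z] := ltnW (deg2 y Py).
  by rewrite inE => /andP[yz /(inp z yz)].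
have [v] : exists v, v \in [set z | e y z && P z] :\ z.
  apply/card_gt0P; have := deg2 y Py; rewrite (cardsD1 z); case: (_ \in _) => /=; lia.
rewrite !inE => /and3P[vz yv Pv].
have := inp v yv Pv; rewrite inE (negPf vz) /= => vp.
move: pp up Pp; case/splitPr: vp => p1 p2.
rewrite -cat_rcons -!cat_cons all_cat cat_uniq => + /andP[up _] /andP[Pp _].
rewrite /= cat_path => /and3P[yz pz _].
(* The initial segment of the path up to [v]; since [v] differs from [z], it has at least three
   vertices. *)
exists (y :: z :: rcons p1 v); split => //; last by rewrite /= size_rcons.
by rewrite /= yz rcons_path pz last_rcons symE.
Qed.

Lemma cycle_nth (T : Type) (e : rel T) (s : seq T) (x0 : T) (i : nat) :
  cycle e s -> (i < size s)%N -> e (nth x0 s i) (nth x0 s (i.+1 %% size s)).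
Proof.
case: s => // x p /= /(pathP x0) H lti.
have := H i; rewrite size_rcons => /(_ lti).
rewrite -rcons_cons !nth_rcons /= lti; case: (ltngtP i (size p)) => [ltp|ltp|->].
- by rewrite modn_small.
- by move: lti; rewrite ltnS leqNgt ltp.
- by rewrite modnn.
Qed.

Lemma ordS_neq (k : nat) (i : 'I_k) : (1 < k)%N -> ordS i != i.
Proof.
move=> k1; rewrite -val_eqE /=; have lti := ltn_ord i.
case: (ltngtP i.+1 k) lti => // [ltS _|E _]; first by rewrite modn_small //; lia.
by rewrite E modnn; lia.
Qed.

Lemma ordS_neq_pred (k : nat) (i : 'I_k) : (2 < k)%N -> ordS i != ord_pred i.
Proof.
(* Applying the successor to both sides turns the claim into i + 2 differing from i modulo k, with
   up to two wrap-arounds to separate. *)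
move=> k2; rewrite -(inj_eq (can_inj (@ordSK k))) ord_predK -val_eqE /=.
have lti := ltn_ord i.
have [lt2|ge2] := ltnP i.+2 k; first by rewrite (@modn_small i.+1) ?modn_small //; lia.
have [lt1|ge1] := ltnP i.+1 k.
  rewrite (@modn_small i.+1) //; have E : i.+2 = k by lia.
  by rewrite E modnn; lia.
have E : i.+1 = k by lia.
by rewrite E modnn modn_small; lia.
Qed.

Lemma cycle_adjE (k : nat) (i j : 'I_k) : (1 < k)%N ->
  cycle_adj i j = (j == ordS i) || (j == ord_pred i).
Proof.
move=> k1; rewrite /cycle_adj -[X in _ && (X || _)]/(j == ordS i).
rewrite -[X in _ && (_ || X)]/(i == ordS j).
rewrite (_ : (i == ordS j) = (j == ord_pred i)); last first.
  by apply/eqP/eqP => ->; rewrite ?ordSK ?ord_predK.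
case: eqVneq => //= ij; rewrite -ij eq_sym (negPf (ordS_neq _ _ k1)) /=.
apply/esym/negP => /eqP E; have := ordS_neq _ (ord_pred i) k1.
by rewrite ord_predK -E eqxx.
Qed.

(** Successor and predecessor on the cycle are two distinct [P]-neighbours, so they exhaust a set of
    size 2: the cycle has no chord and no [P]-edge leaves it. *)
Lemma two_regular_cycle_nbrs (T : finType) (e : rel T) (P : pred T) (s : seq T)
    (x0 : T) (i : 'I_(size s)) :
  symmetric e -> cycle e s -> uniq s -> (2 < size s)%N -> all P s ->
  #|[set y | e (nth x0 s i) y && P y]| = 2 ->
  [set y | e (nth x0 s i) y && P y] = [set nth x0 s (ordS i); nth x0 s (ord_pred i)].
Proof.
move=> symE cs us ks Ps c2; apply/esym/eqP; rewrite eqEcard c2 cards2.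
rewrite nth_uniq // -[(_ != _)]/(ordS i != ord_pred i) ordS_neq_pred // andbT.
have Pn j : (j < size s)%N -> P (nth x0 s j) by move=> lj; apply/(allP Ps)/mem_nth.
rewrite subUset !sub1set !inE !Pn // (cycle_nth _ _ _ x0 i cs) // symE.
have := cycle_nth _ _ _ x0 (ord_pred i) cs (ltn_ord _).
by rewrite -[((ord_pred i).+1 %% _)%N]/(val (ordS (ord_pred i))) ord_predK => ->.
Qed.

Section ExtremalStructure.
Variables (G : sgraph) (w : G).
Hypothesis conG : connected_graph G.
Hypothesis leaf_w : forall v u : G, v \in leaves G -> adj v u -> u = w.
Hypothesis deg_w : deg w = (#|leaves G| + 2)%N.
Hypothesis deg_u : forall u : G, u != w -> deg u != 1%N -> deg u = 2.

Let inner_nbrs (x : G) := [set y | adj x y && (y \notin leaves G)].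

Lemma w_notin_leaves : w \notin leaves G.
Proof. by rewrite inE deg_w; lia. Qed.

Lemma adj_w_leaf (v : G) : v \in leaves G -> adj w v.
Proof.
move=> vL; have [u vu _] := leaf_nbr _ _ vL.
by rewrite adj_sym -(leaf_w _ _ vL vu).
Qed.

(** All leaves hang off [w] and use up its excess; any other non-leaf has no leaf among its two
    neighbours. *)
Lemma card_inner_nbrs (x : G) : x \notin leaves G -> #|inner_nbrs x| = 2.
Proof.
move=> xL; have -> : inner_nbrs x = [set y | adj x y] :\: leaves G.
  by apply/setP => y; rewrite !inE andbC.
have [->|xw] := eqVneq x w.
  have := cardsID (leaves G) [set y | adj w y].
  rewrite (setIidPr _) -/(deg w) ?deg_w; first by lia.
  by apply/subsetP => v vL; rewrite inE adj_w_leaf.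
rewrite (setDidPl _); first by apply: deg_u => //; move: xL; rewrite inE.
rewrite disjoint_sym; apply/pred0P => v /=; apply/negP => /andP[vL].
by rewrite inE adj_sym => /(leaf_w _ _ vL) E; rewrite E eqxx in xw.
Qed.

Lemma inner_cycle : exists p : seq G,
  [/\ cycle (@adj G) (w :: p), uniq (w :: p), (2 < size (w :: p))%N
    & forall x, (x \in w :: p) = (x \notin leaves G)].
Proof.
have [|s [cs us ks Ps]] := @min_deg2_cycle G (@adj G) (fun x => x \notin leaves G) w
  (@adj_sym G) (@adj_irrefl G) _ w_notin_leaves.
  by move=> y yL; rewrite -/(inner_nbrs y) card_inner_nbrs.
have step x y : x \in s -> adj x y -> y \notin leaves G -> y \in s.
  move=> xs xy yL; have ltx : (index x s < size s)%N by rewrite index_mem.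
  have := @two_regular_cycle_nbrs G (@adj G) (fun x => x \notin leaves G) s x
    (Ordinal ltx) (@adj_sym G) cs us ks Ps.
  rewrite /= nth_index // card_inner_nbrs ?(allP Ps) // => /(_ erefl)/setP/(_ y).
  by rewrite inE xy yL => /esym/set2P[]->; apply: mem_nth; apply: ltn_pmod; lia.
have [x xs] : exists x, x \in s by case: (s) ks => // a l _; exists a; rewrite inE eqxx.
have sE y : y \notin leaves G -> y \in s.
  (* Leaves are included exactly when [w] lies on the cycle; since they touch only [w], this makes
     [S] closed under adjacency. *)
  move=> yL; pose S : pred G := fun z => (z \in s) || (z \in leaves G) && (w \in s).
  suff : S y by rewrite /S (negPf yL) orbF.
  apply: (@connected_closed G S x y conG) => [a b aS ab|].
    change (S b); case/orP: (aS : S a) => [{}aS|/andP[aL ws]]; rewrite /S.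
      case: (boolP (b \in leaves G)) => [bL|bL]; last by rewrite (step a).
      by rewrite -(leaf_w _ a bL) ?aS ?orbT // adj_sym.
    by rewrite (leaf_w _ _ aL ab) ws.
  by change (S x); rewrite /S xs.
(* Rotating puts [w] at index 0, the attachment vertex of [cycle_pendant]. *)
have [i p sp] := rot_to (sE _ w_notin_leaves).
exists p; rewrite -sp rot_cycle rot_uniq size_rot; split=> // y.
by rewrite mem_rot; apply/idP/idP => [/(allP Ps)|/sE].
Qed.

Lemma extremal_isomorphic :
  isomorphic G (cycle_pendant (#|G| - #|leaves G|) #|leaves G|).
Proof.
have [p [cs us ks sE]] := inner_cycle; move: cs us ks sE.
set s := w :: p => cs us ks sE.
have sizeE : (#|G| - #|leaves G|)%N = size s.
  rewrite -(cardsC (leaves G)) addKn -(card_uniqP us); apply: eq_card => x.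
  by rewrite inE sE.
rewrite sizeE.
(* Cycle indices go to the vertices of [s] in order, pendant indices to an enumeration of the
   leaves; the isomorphism sought is the inverse of [f]. *)
pose f (z : cycle_pendant (size s) #|leaves G|) : G :=
  match z with inl i => nth w s i | inr j => enum_val j end.
have sL (i : 'I_(size s)) : nth w s i \notin leaves G by rewrite -sE mem_nth.
have fI : injective f.
  move=> [i|j] [i'|j'] /= E.
  - by move/eqP: E; rewrite nth_uniq // => /eqP/val_inj ->.
  - by have := sL i; rewrite E enum_valP.
  - by have := sL i'; rewrite -E enum_valP.
  - by congr inr; apply: enum_val_inj.
have Ps : all (fun x => x \notin leaves G) s by apply/allP => x; rewrite sE.
have f_adj a b : adj (f a) (f b) = adj a b.
  have nbr_leaf (i : 'I_(size s)) (j : 'I_#|leaves G|) :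
      adj (nth w s i) (enum_val j) = (i == 0%N :> nat).
    rewrite -[in RHS](nth_uniq w _ _ us) //=.
    apply/idP/eqP => [|->]; last by rewrite adj_w_leaf ?enum_valP.
    by rewrite adj_sym => /(leaf_w _ _ (enum_valP j)).
  case: a b => [i|j] [i'|j'] //=; last first.
  - apply/negP => /(leaf_w _ _ (enum_valP j)) E.
    by have := enum_valP j'; rewrite E (negPf w_notin_leaves).
  - by rewrite adj_sym.
  have := @two_regular_cycle_nbrs G (@adj G) (fun x => x \notin leaves G) s w i
    (@adj_sym G) cs us ks Ps (card_inner_nbrs _ (sL i)).
  move/setP/(_ (nth w s i')); rewrite in_set sL andbT in_set2 => ->.
  by rewrite !nth_uniq // cycle_adjE // ltnW.
have [|g fK gK] := inj_card_bij fI.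
  by rewrite card_sum !card_ord -sizeE subnK // max_card.
exists g; split; first by exists f.
by move=> x y; rewrite -f_adj !gK.
Qed.

End ExtremalStructure.

(** * Isomorphism invariance and the index of the extremal graph *)

Lemma isomorphic_deg (G H : sgraph) (f : G -> H) (u : G) : bijective f ->
  (forall x y, adj (f x) (f y) = adj x y) -> deg (f u) = deg u.
Proof.
move=> bf fE; rewrite /deg -(card_imset _ (bij_inj bf)); apply: eq_card => y.
have [g fK gK] := bf; rewrite inE -[y]gK fE mem_imset ?inE //; exact: bij_inj.
Qed.

Lemma isomorphic_zeroth_randic (R : realType) (gamma : R) (G H : sgraph) :
  isomorphic G H -> zeroth_randic gamma G = zeroth_randic gamma H.
Proof.
case=> f [bf fE]; rewrite /zeroth_randic [RHS](reindex f) /=; last exact: onW_bij.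
by apply: eq_bigr => u _; rewrite (isomorphic_deg _ _ _ _ bf fE).
Qed.

Lemma deg_cycle_pendant_inl (k c : nat) (i : 'I_k) : (2 < k)%N ->
  deg (inl i : cycle_pendant k c) = (2 + if i == 0%N :> nat then c else 0)%N.
Proof.
move=> k2; rewrite /deg -sum1dep_card big_sumType /=; congr (_ + _)%N.
  rewrite sum1dep_card (_ : [set _ | _] = [set ordS i; ord_pred i]).
    by rewrite cards2 ordS_neq_pred.
  by apply/setP => j; rewrite !inE cycle_adjE // ltnW.
case: eqP => _; last by rewrite big_pred0.
by rewrite sum1_card card_ord.
Qed.

Lemma deg_cycle_pendant_inr (k c : nat) (j : 'I_c) : (0 < k)%N ->
  deg (inr j : cycle_pendant k c) = 1%N.
Proof.
case: k => // k _; rewrite /deg -sum1dep_card big_sumType /= [X in (_ + X)%N]big_pred0 //.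
by rewrite addn0 (big_pred1 ord0).
Qed.

Lemma zeroth_randic_cycle_pendant (R : realType) (gamma : R) (k c : nat) : (2 < k)%N ->
  zeroth_randic gamma (cycle_pendant k c)
  = (c%:R + (k - 1)%:R * 2 `^ gamma + (c + 2)%:R `^ gamma)%R.
Proof.
move=> k2; rewrite /zeroth_randic big_sumType /= addrC.
rewrite (eq_bigr (fun=> 1%R)); last first.
  by move=> j _; rewrite deg_cycle_pendant_inr ?powR1 //; lia.
rewrite sumr_const card_ord -addrA; congr (_ + _)%R.
case: k k2 => // k k2; rewrite big_ord_recl deg_cycle_pendant_inl //= addrC addnC.
congr (_ + _)%R; rewrite (eq_bigr (fun=> 2 `^ gamma)%R).
  by rewrite sumr_const card_ord subn1 mulr_natl.
by move=> i _; rewrite deg_cycle_pendant_inl.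
Qed.

(** * Convexity and sums of powers of degrees *)

Local Open Scope ring_scope.

Lemma ltr_powR_neg (R : realType) (gamma x y : R) :
  gamma < 0 -> 0 < x -> x < y -> y `^ gamma < x `^ gamma.
Proof.
move=> gamma_lt0 x0 xy; have y0 : 0 < y by apply: lt_trans xy.
have -> : gamma = - (- gamma) by rewrite opprK.
rewrite (powRN y) (powRN x) ltf_pV2 ?posrE ?powR_gt0 //.
by apply: gt0_ltr_powR; rewrite ?oppr_gt0 ?nnegrE ?ltW.
Qed.

(* AM-GM for the squares of [d `^ (gamma / 2)] and [d.+2 `^ (gamma / 2)],
   whose product exceeds [d.+1 `^ gamma] because [d * d.+2 < d.+1 ^ 2]. *)
Lemma powR_neg_nat_convex (R : realType) (gamma : R) (d : nat) :
  gamma < 0 -> (0 < d)%N ->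
  d.+1%:R `^ gamma - d.+2%:R `^ gamma < d%:R `^ gamma - d.+1%:R `^ gamma :> R.
Proof.
move=> g0 d0; set h := gamma / 2.
have h0 : h < 0 by rewrite /h; lra.
have split_pow (x : R) : 0 < x -> x `^ gamma = x `^ h * x `^ h.
  move=> x0; rewrite -powRD; last by apply/implyP => _; rewrite gt_eqF.
  by congr (_ `^ _); rewrite /h; field.
have ltm : d.+1%:R `^ gamma < d%:R `^ h * d.+2%:R `^ h :> R.
  rewrite split_pow ?ltr0n // -!powRM ?ler0n //.
  apply: ltr_powR_neg => //; first by rewrite mulr_gt0 ?ltr0n.
  by rewrite -!natrM ltr_nat; lia.
rewrite (split_pow d%:R) ?ltr0n // (split_pow d.+2%:R) ?ltr0n //.
have := sqr_ge0 (d%:R `^ h - d.+2%:R `^ h : R).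
by nra.
Qed.

Section DegreeSum.
Variables (R : realType) (gamma : R).
Hypothesis gamma_lt0 : gamma < 0.

Definition pow_drop (d a : nat) : R := d%:R `^ gamma - (d + a)%:R `^ gamma.

Lemma pow_drop0 d : pow_drop d 0 = 0.
Proof. by rewrite /pow_drop addn0 subrr. Qed.

(** Convexity chained from [d] to [d + a]. Base [d + b] serves subadditivity, base 1 the
    monotonicity of [leaf_bound]. *)
Lemma pow_drop_step d a : (0 < d)%N -> (0 < a)%N ->
  (d + a)%:R `^ gamma - (d + a).+1%:R `^ gamma
    < d%:R `^ gamma - d.+1%:R `^ gamma :> R.
Proof.
move=> d0; elim: a => // -[|a] IHa _.
  by rewrite addn1; apply: powR_neg_nat_convex.
apply: lt_trans (IHa isT); rewrite !(addnS d a.+1).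
by apply: powR_neg_nat_convex => //; rewrite addn_gt0 d0.
Qed.

Lemma ltr_pow_drop d a b : (0 < d)%N -> (a < b)%N -> pow_drop d a < pow_drop d b.
Proof.
move=> d0 ab; rewrite /pow_drop ltrD2l ltrN2.
by apply: ltr_powR_neg; rewrite ?ltr0n ?ltr_nat ?addn_gt0 ?d0 ?ltn_add2l.
Qed.

Lemma ler_pow_drop d a b : (0 < d)%N -> (a <= b)%N -> pow_drop d a <= pow_drop d b.
Proof.
by move=> d0; rewrite leq_eqVlt => /orP[/eqP->|/(ltr_pow_drop _ _ _ d0)/ltW].
Qed.

(** Induction on [b]: raising [b] by one adds less to the drop when it starts [a] further along. *)
Lemma pow_drop_subadd_lt d a b : (0 < d)%N -> (0 < a)%N -> (0 < b)%N ->
  pow_drop d (a + b) < pow_drop d a + pow_drop d b.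
Proof.
move=> d0 a0; elim: b => // b IHb _.
have step : pow_drop d (a + b.+1) - pow_drop d (a + b)
          < pow_drop d b.+1 - pow_drop d b.
  have := @pow_drop_step (d + b) a _ a0; rewrite addn_gt0 d0 /= => /(_ isT).
  rewrite /pow_drop !addnS (addnAC d b a) -addnA; lra.
case: b IHb step => [_|b /(_ isT)]; last by lra.
by rewrite addn0 pow_drop0; lra.
Qed.

Lemma pow_drop_subadd d a b : (0 < d)%N ->
  pow_drop d (a + b) <= pow_drop d a + pow_drop d b.
Proof.
case: a => [|a]; first by rewrite add0n pow_drop0 add0r.
case: b => [|b]; first by rewrite addn0 pow_drop0 addr0.
by move=> d0; apply/ltW/pow_drop_subadd_lt.
Qed.

Lemma pow_drop_sum (T : finType) (P : pred T) (a : T -> nat) d : (0 < d)%N ->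
  pow_drop d (\sum_(u | P u) a u)%N <= \sum_(u | P u) pow_drop d (a u).
Proof.
move=> d0; elim/big_rec2: _ => [|u x y _ IH]; first by rewrite pow_drop0.
by apply: le_trans (pow_drop_subadd _ _ _ d0) _; rewrite lerD2l.
Qed.

(** If the indices other than [w] had positive total, strict subadditivity between [a w] and that
    total would contradict the assumed inequality. *)
Lemma pow_drop_sum_eq (T : finType) (P : pred T) (a : T -> nat) d w :
  (0 < d)%N -> P w -> (0 < a w)%N ->
  \sum_(u | P u) pow_drop d (a u) <= pow_drop d (\sum_(u | P u) a u)%N ->
  forall u, P u -> u != w -> a u = 0%N.
Proof.
move=> d0 Pw aw; rewrite (bigD1 w) //= [in X in _ <= X](bigD1 w) //=.
have := pow_drop_sum _ (fun u => P u && (u != w)) a d d0.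
set A := (\sum_(i | _) a i)%N => leA leS u Pu uw.
have A0 : A = 0%N.
  case: (posnP A) => // A_gt0.
  suff : false by []; have := pow_drop_subadd_lt d (a w) A d0 aw A_gt0.
  by rewrite ltNge => /negP[]; apply: le_trans leS; rewrite lerD2l.
by have /eqP := A0; rewrite sum_nat_eq0 => /forallP/(_ u); rewrite Pu uw => /eqP.
Qed.

(** The power sum of p ones, n - p - 1 twos and one p + 2: all n - p non-leaves are counted as twos,
    then one drop is subtracted. *)
Definition leaf_bound (n p : nat) : R :=
  p%:R + (n%:R - p%:R) * 2 `^ gamma - pow_drop 2 p.

(** The increase is (f 1 - f 2) - (f (p + 2) - f (p + 3)), positive by convexity. *)
Lemma leaf_boundS n p : leaf_bound n p < leaf_bound n p.+1.
Proof.
have := @pow_drop_step 1 p.+1 isT isT.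
rewrite /leaf_bound /pow_drop powR1 !add1n -[p.+1%:R]natr1 addnS add2n; lra.
Qed.

Lemma leaf_bound_lt n p q : (p < q)%N -> leaf_bound n p < leaf_bound n q.
Proof.
elim: q => // q IHq; rewrite ltnS leq_eqVlt => /orP[/eqP->|/IHq].
  exact: leaf_boundS.
by move/lt_trans; apply; apply: leaf_boundS.
Qed.

Lemma leaf_boundE n c : (c < n)%N -> leaf_bound n c =
  c%:R + (n - c - 1)%:R * 2 `^ gamma + (c + 2)%:R `^ gamma.
Proof.
move=> cn; rewrite /leaf_bound /pow_drop (addnC 2%N) -subnDA addn1 natrB //.
by rewrite -natr1; ring.
Qed.

(** * Power sums of positive integer sequences with mean at least 2 *)

Section Sequence.
Variables (T : finType) (d : T -> nat).
Hypothesis d_gt0 : forall u, (0 < d u)%N.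
Hypothesis d_sum : (2 * #|T| <= \sum_u d u)%N.

Let p := #|[set u | d u == 1%N]|.

Lemma card_not_one : (p + #|[pred u | d u != 1%N]| = #|T|)%N.
Proof. by rewrite /p cardsE -(cardC [pred u | d u == 1%N]). Qed.

(** Each 1 falls short of the mean 2 by one, which the other terms must make up. These are at least
    2, so the truncated subtraction is exact. *)
Lemma excess_sum : (p <= \sum_(u | d u != 1%N) (d u - 2))%N.
Proof.
move: d_sum; rewrite (bigID (fun u => d u == 1%N)) /=.
rewrite (eq_bigr (fun=> 1%N)) => [|u /eqP //].
rewrite [X in (_ + X)%N](eq_bigr (fun u => d u - 2 + 2)%N); last first.
  by move=> u u1; have := d_gt0 u; lia.
rewrite big_split /= !sum_nat_cond_const -card_not_one -/p.
rewrite [X in (_ + (_ + X * 2))%N](_ : _ = #|[pred u | d u != 1%N]|) ?cardsE //.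
by set S := (\sum_(_ | _) _)%N; set q := #|_|; lia.
Qed.

Lemma pow_sum_excess : \sum_u (d u)%:R `^ gamma
  = p%:R + (#|T|%:R - p%:R) * 2 `^ gamma - \sum_(u | d u != 1%N) pow_drop 2 (d u - 2).
Proof.
rewrite (bigID (fun u => d u == 1%N)) /= (eq_bigr (fun=> 1)); last first.
  by move=> u /eqP ->; rewrite powR1.
rewrite [X in _ + X](eq_bigr (fun u => 2 `^ gamma - pow_drop 2 (d u - 2))); last first.
  move=> u u1; have := d_gt0 u => d0; rewrite /pow_drop subnKC; first by ring.
  by lia.
rewrite big_split /= sumrN !sumr_const addrA -card_not_one natrD.
by rewrite [p%:R + #|_|%:R]addrC addrK mulr_natl /p cardsE.
Qed.

Lemma pow_sum_le : \sum_u (d u)%:R `^ gamma <= leaf_bound #|T| p.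
Proof.
rewrite pow_sum_excess lerD2l lerN2.
apply: le_trans (pow_drop_sum _ _ _ _ _) => //.
by apply: ler_pow_drop => //; apply: excess_sum.
Qed.

(** Strict monotonicity of the drop forces total excess exactly [p]. As [p] is positive, some [w]
    has excess, and strict subadditivity leaves none for the others. *)
Lemma pow_sum_eq : (0 < p)%N -> \sum_u (d u)%:R `^ gamma = leaf_bound #|T| p ->
  exists w, d w = (p + 2)%N /\ forall u, u != w -> d u != 1%N -> d u = 2.
Proof.
move=> p0; rewrite pow_sum_excess /leaf_bound => /addrI/oppr_inj eqS.
have le1 : \sum_(u | d u != 1%N) pow_drop 2 (d u - 2)
    <= pow_drop 2 (\sum_(u | d u != 1%N) (d u - 2))%N.
  by rewrite eqS; apply: ler_pow_drop => //; apply: excess_sum.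
have sumE : (\sum_(u | d u != 1%N) (d u - 2) = p)%N.
  apply/eqP; rewrite eqn_leq excess_sum andbT leqNgt; apply/negP => ltp.
  have := ltr_pow_drop 2 _ _ isT ltp; rewrite -eqS ltNge => /negP; apply.
  exact: pow_drop_sum.
have [w /andP[w1 dw]] : exists w, (d w != 1%N) && (0 < d w - 2)%N.
  apply/existsP; apply: contraLR p0 => /existsPn H.
  rewrite -sumE big1 // => u u1; have := H u; rewrite u1 /= -leqNgt leqn0.
  by move/eqP.
have oth : forall u, d u != 1%N -> u != w -> (d u - 2 = 0)%N.
  exact: (pow_drop_sum_eq _ _ (fun u => d u - 2)%N 2 w isT w1 dw le1).
exists w; split.
  move: sumE; rewrite (bigD1 w) //= big1 => [|u /andP[u1 uw]]; last exact: oth.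
  by lia.
by move=> u uw u1; have := oth u u1 uw; have := d_gt0 u; lia.
Qed.

End Sequence.
End DegreeSum.

Theorem theorem3p5 (R : realType) (n c : nat) (gamma : R) (G : sgraph) :
  (1 <= c)%N -> (c <= n - 3)%N -> gamma < 0 ->
  connected_graph G -> graph_order G = n -> #|cut_edges G| = c ->
  zeroth_randic gamma G
    <= c%:R + (n - c - 1)%:R * 2 `^ gamma + (c + 2)%:R `^ gamma
  /\ (zeroth_randic gamma G
        = c%:R + (n - c - 1)%:R * 2 `^ gamma + (c + 2)%:R `^ gamma
      <-> isomorphic G (cycle_pendant (n - c) c)).
Proof.
rewrite /graph_order => c1 cn g0 conG nG cG.
(* Since [c] is positive, the truncated difference n - 3 is positive too. *)
have n3 : (3 < #|G|)%N by rewrite nG; lia.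
have dpos (u : G) : (0 < deg u)%N by apply: connected_deg_gt0 => //; lia.
have dsum : (2 * #|G| <= \sum_(u : G) deg u)%N.
  by apply: few_cut_edges_deg_sum => //; rewrite nG cG; lia.
have := leaves_le_cut_edges G conG (ltnW n3); rewrite cG => leLc.
have le1 := pow_sum_le R gamma g0 G (@deg G) dpos dsum.
rewrite nG -/(leaves G) -/(zeroth_randic gamma G) in le1.
have cltn : (c < n)%N by lia.
rewrite -(leaf_boundE R gamma n c cltn).
have le2 : leaf_bound R gamma n #|leaves G| <= leaf_bound R gamma n c.
  by move: leLc; rewrite leq_eqVlt => /orP[/eqP->//|/(leaf_bound_lt R gamma g0 n _ _)/ltW].
split; first exact: le_trans le1 le2.
split=> [eqc|iso]; last first.
  rewrite (isomorphic_zeroth_randic _ gamma _ _ iso) leaf_boundE //.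
  by apply: zeroth_randic_cycle_pendant; lia.
(* Fewer than [c] leaves would make the bound strict. *)
have Lc : #|leaves G| = c.
  move: leLc; rewrite leq_eqVlt => /orP[/eqP//|/(leaf_bound_lt R gamma g0 n _ _)].
  by rewrite -eqc ltNge le1.
have [||w [dw du]] := pow_sum_eq R gamma g0 G (@deg G) dpos dsum.
- by rewrite -/(leaves G) Lc.
- by rewrite nG -/(leaves G) Lc.
(* A leaf's neighbour other than [w] would have degree 1 or 2: [leaf_not_adj] excludes the first,
   [leaf_nbr_deg] the second. *)
rewrite -nG -Lc; apply: (extremal_isomorphic G w) => // v u vL vu.
apply/eqP; apply: contraT => uw.
have := leaf_nbr_deg G v u conG n3 _ vL vu; rewrite Lc cG => /(_ erefl).
rewrite du //; apply: contraL vu => u1; apply: leaf_not_adj => //; first exact: ltnW.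
by rewrite inE.
Qed.
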